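(* Let $\kappa$ be a regular cardinal, let $A\subset\mathbb N^*$ be a simple almost clopen set of type $\kappa$, and let $B=\{x_A\}\cup(\mathbb N^*\setminus A)$ be its almost clopen complement. If $B$ is simple (i.e. simple of some type), then $B$ also has type $\kappa$.
   Context: $\mathbb N^*=\beta\mathbb N\setminus\mathbb N$ is the space of free ultrafilters on $\mathbb N$; for $a\subset\mathbb N$, $a^*$ is the basic clopen set of all free ultrafilters containing $a$. For subsets of $\mathbb N$, $a\subset^* b$ means $a\setminus b$ is finite. A set $A\subset\mathbb N^*$ is almost clopen if $A$ is the closure of an open subset of $\mathbb N^*$ and has a unique boundary point, which is denoted $x_A$. In that case $B=\{x_A\}\cup(\mathbb N^*\setminus A)$ is also almost clopen, with $x_B=x_A$; it is called the almost clopen complement of $A$. For $A\subset\mathbb N^*$, $\mathcal I_A=\{a\subset\mathbb N: a^*\subset A\}$. For a regular cardinal $\kappa$, an almost clopen set $A$ is simple of type $\kappa$ if $\mathcal I_A$ has a $\subset^*$-cofinal $\subset^*$-increasing chain $\{a_\alpha:\alpha\in\kappa\}$ of type $\kappa$. It is simple if it is simple of type $\kappa$ for some regular cardinal $\kappa$. *)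

(* Defs.v *)
From HB Require Import structures.
From mathcomp Require Import all_boot all_order.
From mathcomp Require Import boolp classical_sets functions cardinality filter.
From mathcomp Require Import wochoice topology.

Set Implicit Arguments.
Unset Strict Implicit.
Unset Printing Implicit Defensive.

Local Open Scope classical_set_scope.
Local Open Scope card_scope.

Record Nstar : Type := MkNstar {
  ufilter :> set_system nat;
  ufilter_ultra : UltraFilter ufilter;
  ufilter_free : \bigcap_(a in ufilter) a = set0
}.

HB.instance Definition _ := gen_eqMixin Nstar.
HB.instance Definition _ := gen_choiceMixin Nstar.

Definition star (a : set nat) : set Nstar := [set p | ufilter p a].

Lemma star_cover : \bigcup_(a in [set: set nat]) star a = [set: Nstar].
Proof.
apply/seteqP; split=> // p _; exists setT => //=.
by have up := ufilter_ultra p; apply: filterT.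
Qed.

Lemma star_join (a b : set nat) (p : Nstar) :
  [set: set nat] a -> [set: set nat] b -> star a p -> star b p ->
  exists c, [/\ [set: set nat] c, star c p & star c `<=` star a `&` star b].
Proof.
move=> _ _ pa pb; exists (a `&` b); split=> //.
  by have up := ufilter_ultra p; apply: filterI.
move=> q qab; have uq := ufilter_ultra q.
by split; apply: filterS qab => n [].
Qed.

HB.instance Definition _ := isBaseTopological.Build Nstar star_cover star_join.

Definition boundary (T : topologicalType) (A : set T) : set T :=
  closure A `\` A°.

Definition almost_clopen (A : set Nstar) : Prop :=
  (exists2 U : set Nstar, open U & A = closure U) /\
  (exists! x : Nstar, boundary A x).

Definition almost_subset (a b : set nat) : Prop := finite_set (a `\` b).

Definition clopen_ideal (A : set Nstar) : set (set nat) :=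
  [set a | star a `<=` A].

(* An infinite cardinal is presented as (a well-order isomorphic to) an initial
   ordinal: every proper initial segment has smaller cardinality.  It is regular
   if every cofinal subset has full cardinality.  [R] is the reflexive order. *)
Definition regular_cardinal (K : Type) (R : rel K) : Prop :=
  [/\ well_order R,
      infinite_set [set: K],
      forall x : K, ~ ([set: K] #<= [set y | R y x /\ y <> x]) &
      forall C : set K, (forall x : K, exists2 y, C y & R x y) ->
        [set: K] #<= C].

(* As [almost_subset] is not strict, the chain is only required to increase
   weakly; when [A] is almost clopen it cannot stabilize, because an
   [almost_subset]-largest member [a] of [clopen_ideal A] would give
   [A = star a], which has empty boundary. *)
Definition simple_of_type (K : Type) (R : rel K) (A : set Nstar) : Prop :=
  almost_clopen A /\
  exists a : K -> set nat,
    [/\ forall i, clopen_ideal A (a i),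
        forall i j, R i j -> almost_subset (a i) (a j) &
        forall c, clopen_ideal A c -> exists i, almost_subset c (a i)].

Definition simple (A : set Nstar) : Prop :=
  exists (K : Type) (R : rel K), regular_cardinal R /\ simple_of_type R A.

(* Main.v *)
Require Import Defs.
From mathcomp Require Import all_boot all_order.
From mathcomp Require Import boolp classical_sets functions cardinality filter.
From mathcomp Require Import wochoice topology.
From mathcomp Require Import zify.
Local Open Scope classical_set_scope.
Local Open Scope card_scope.

(** Let [B] be the complement of [A] together with [x], and let [a_i] (i in K)
    and [b_l] (l in L) be cofinal chains of the two ideals.  Since [x] is the
    only point that belongs to neither of the open sets [A°] and [~` A], a set
    [c] belongs to [x] exactly when [~` c] is almost covered by some union of an
    [a_i] and a [b_l] ([clopen_ideals_generate]).  As [a_i] and [b_l] always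
    have finite intersection, the increments [D_i] of the first chain (what some
    later, essentially larger term adds to [a_i]) are eventually almost
    contained in every given member of [x], and so are the increments [E_l] of
    the second chain ([chain_increments_converge]).

    The point is that two sequences of infinite sets cannot converge to the same
    free ultrafilter at such different speeds that every map from K to L is
    bounded ([exists_unbounded_map]).  If they did, any K many members of [x]
    would have some [E_l] as a common pseudo-intersection, and two cases arise.

    - Some [g] is such that, for every i, the set of those n for which [D_i]
      meets [n, g n] belongs to [x].  Take [E_l] almost contained in all of
      these sets.  Splitting a sparse subset of [E_l] in two, and thickening its
      points n to [n, g n], gives a set [c] that every [D_i] splits; but [x]
      decides [c], so some [D_i] does not.

    - No such [g] exists.  Then for every [g] there is an i such that,
      for x-many n, the least element of [D_i] above n exceeds g n.  Some [D_j]
      is almost contained in the set of these n.  Thus the maps sending n to an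
      element of [D_i] above an element of [D_j] above n form a dominating
      family indexed by pairs (i, j).  Each of them yields a partition into intervals
      and, taking every other interval, a set that [x] decides.  A single [E_l]
      respects all these decisions, yet its own enumeration is dominated by one
      of the maps, so [E_l] meets almost all intervals of that partition and is
      split.

    So there are unbounded maps from K to L and from L to K.  By regularity the
    two cardinals are equal, whence a monotone cofinal map from K to L
    ([regular_monotone_cofinal]), along which the chain of [B] is reindexed
    by K. *)

(** * Subsets of the natural numbers modulo finite sets *)

Lemma finite_nat_setP (a : set nat) :
  finite_set a <-> exists N, forall n, N <= n -> ~ a n.
Proof.
split=> [/finite_seqP[s ->]|[N aN]].
  exists (\max_(i <- s) i).+1 => n nN sn.
  by have := @leq_bigmax_seq _ s xpredT id n sn isT; lia.
apply: sub_finite_set (finite_II N) => n an /=.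
by rewrite ltnNge; apply/negP => /aN; apply.
Qed.

Lemma infinite_nat_setP (a : set nat) :
  infinite_set a <-> forall N, exists2 n, N <= n & a n.
Proof.
split=> [ainf N|aunb /finite_nat_setP[N aN]]; last first.
  by have [n /aN] := aunb N.
apply: contrapT => noN; apply/ainf/finite_nat_setP; exists N => n Nn an.
by apply: noN; exists n.
Qed.

Lemma almost_subsetP (a b : set nat) :
  almost_subset a b <-> exists N, forall n, N <= n -> a n -> b n.
Proof.
rewrite /almost_subset finite_nat_setP; split=> -[N abN]; exists N => n Nn.
  by move=> an; apply: contrapT => bn; apply: (abN n Nn).
by case=> an; apply; apply: abN.
Qed.

Lemma subset_almost {a b : set nat} : a `<=` b -> almost_subset a b.
Proof. by move=> ab; apply/almost_subsetP; exists 0 => n _; apply: ab. Qed.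

Lemma almost_subset_trans {a b c : set nat} :
  almost_subset a b -> almost_subset b c -> almost_subset a c.
Proof.
move=> /almost_subsetP[M ab] /almost_subsetP[N bc]; apply/almost_subsetP.
by exists (maxn M N) => n nMN /ab-/(_ _)/bc; apply; lia.
Qed.

Lemma almost_subsetI {a b c : set nat} :
  almost_subset a b -> almost_subset a c -> almost_subset a (b `&` c).
Proof.
move=> /almost_subsetP[M ab] /almost_subsetP[N ac]; apply/almost_subsetP.
by exists (maxn M N) => n nMN an; split; [apply: ab | apply: ac] => //; lia.
Qed.

Lemma infinite_next {a : set nat} :
  infinite_set a -> exists f : nat -> nat, forall n, n <= f n /\ a (f n).
Proof.
move=> /infinite_nat_setP aunb.
suff nextP N : exists n, N <= n /\ a n by have [f fP] := choice nextP; exists f.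
by have [n Nn an] := aunb N; exists n.
Qed.

(** Choose points of [P] so sparse that the intervals [n, g n] they start are
    disjoint, and collect every other one of these intervals in [c].  A set that
    meets almost all intervals has infinitely many points in the collected ones
    and infinitely many in the others. *)
Lemma interval_splitting (P : set nat) (g : nat -> nat) : infinite_set P ->
  exists c : set nat, forall X : set nat,
    (exists N, forall n, N <= n -> P n -> exists2 m, X m & n <= m <= g n) ->
    ~ almost_subset X c /\ ~ almost_subset X (~` c).
Proof.
move=> /infinite_next[next nextP].
pose u k := iter k (fun n => next (maxn n (g n)).+1) (next 0).
have Pu k : P (u k).
  by case: k => [|k]; [case: (nextP 0) | case: (nextP (maxn (u k) (g (u k))).+1)].
have uS k : u k < u k.+1 /\ g (u k) < u k.+1.
  by have [] := nextP (maxn (u k) (g (u k))).+1; rewrite -[next _]/(u k.+1); lia.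
have u_mono : {homo u : i j / i <= j}.
  by apply: homo_leq => [//|i j k|k]; [exact: leq_trans | case: (uS k) => /ltnW].
have u_ge k : k <= u k.
  by elim: k => // k IHk; apply: leq_ltn_trans IHk _; case: (uS k).
exists [set m | exists k, u k.*2 <= m <= g (u k.*2)] => X [N XN].
split=> /almost_subsetP[M]; pose k := maxn M N.
- have [||m Xm /andP[um mg] /(_ m)] := XN (u k.*2.+1) => //.
    by have := u_ge k.*2.+1; lia.
  have uk := u_ge k.*2.+1; case=> [||k' /andP[um' mg']] //; first by lia.
  case: (leqP k' k) => kk'.
    have /u_mono : k'.*2.+1 <= k.*2.+1 by lia.
    by have [_] := uS k'.*2; lia.
  have /u_mono : k.*2.+2 <= k'.*2 by lia.
  by have [_] := uS k.*2.+1; lia.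
- have uk := u_ge k.*2; have [||m Xm umg /(_ m)] := XN (u k.*2) => //.
    by lia.
  by case=> //; [lia | exists k].
Qed.

(** * Well-orders and regular cardinals *)

(** For a regular cardinal [L] this means that [I] is smaller than [L].  In this
    form it passes to pairs by bounding one coordinate after the other, with no
    cardinal arithmetic. *)
Definition bounded_maps (I L : Type) (S : rel L) :=
  forall f : I -> L, exists l, forall i, S (f i) l.

Lemma bounded_maps_pair {I L : Type} {S : rel L} : transitive S ->
  bounded_maps I L S -> bounded_maps (I * I) L S.
Proof.
move=> Str bI f.
have [l lP] := choice (fun i => bI (fun j => f (i, j))).
by have [m mP] := bI l; exists m => -[i j]; apply: Str (lP i j) (mP i).
Qed.

Lemma well_order_min {T : Type} {R : rel T} : well_order R ->
  forall P : set T, P !=set0 -> exists2 m, P m & forall y, P y -> R m y.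
Proof.
move=> woR P [z Pz]; have [|m [[Pm m_min] _]] := woR (fun y => `[< P y >]).
  by exists z; apply/asboolP.
by exists m => [|y Py]; [exact/asboolP | apply/m_min/asboolP].
Qed.

Lemma well_order_total {T : Type} {R : rel T} : well_order R -> total R.
Proof.
move=> woR x y.
have [|m [->|->] m_min] := well_order_min woR [set x; y]; first by exists x; left.
  by rewrite m_min //; right.
by rewrite m_min ?orbT //; left.
Qed.

Lemma well_order_anti {T : Type} {R : rel T} : well_order R -> antisymmetric R.
Proof.
move=> woR x y /andP[xy yx]; pose P z := `[< z = x \/ z = y >].
have [|m [_ m_uniq]] := woR P; first by exists x; apply/asboolP; left.
have Rxx z : R z z by have /orP[] := well_order_total woR z z.
rewrite -(m_uniq x); first rewrite -(m_uniq y) //.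
- by split=> [|z /asboolP[]->] //; apply/asboolP; right.
- by split=> [|z /asboolP[]->] //; apply/asboolP; left.
Qed.

Lemma well_order_trans {T : Type} {R : rel T} : well_order R -> transitive R.
Proof.
move=> woR y x z xy yz; have anti := well_order_anti woR.
have [|m mP m_min] := well_order_min woR [set t | [\/ t = x, t = y | t = z]].
  by exists x; constructor 1.
have Rmx := m_min x (Or31 _ _ erefl); have Rmy := m_min y (Or32 _ _ erefl).
have Rmz := m_min z (Or33 _ _ erefl).
case: mP => mE; subst m => //.
  by rewrite (anti x y) // xy.
by rewrite -(anti y z) // yz.
Qed.

Lemma unbounded_map_cofinal {K L : Type} {S : rel L} : total S ->
  ~ bounded_maps K L S -> exists f : K -> L, forall l, exists i, S l (f i).
Proof.
move=> Stot /existsNP[f nbf]; exists f => l; apply: contrapT => nol.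
apply: nbf; exists l => i; have /orP[//|lfi] := Stot (f i) l.
by case: nol; exists i.
Qed.

Lemma regular_no_max {K : Type} {R : rel K} : regular_cardinal R ->
  forall i, exists j, R i j /\ j <> i.
Proof.
move=> [woR Kinf _ Rreg] i; apply: contrapT => imax.
apply: (Kinf); apply: card_le_finite (finite_set1 i); apply: Rreg => j.
exists i => //; have /orP[//|ij] := well_order_total woR j i.
have [ji|ji] := pselect (j = i); first by rewrite -ji in ij *.
by case: imax; exists j.
Qed.

(** The images of the two unbounded maps are cofinal, so regularity of K gives
    that K is at most as large as L.  A proper initial segment of K is then
    smaller than L, and its image under a cofinal [f] has an upper bound by
    regularity of L; sending each i to the least upper bound of the image of
    the segment below it is monotone. *)
Lemma regular_monotone_cofinal {K L : Type} {R : rel K} {S : rel L} :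
  regular_cardinal R -> regular_cardinal S ->
  ~ bounded_maps K L S -> ~ bounded_maps L K R ->
  exists f : K -> L,
    (forall i j, R i j -> S (f i) (f j)) /\ forall l, exists i, S l (f i).
Proof.
move=> regK regL nbKL nbLK.
have [woR _ Kinit Kreg] := regK; have [woS _ _ Lreg] := regL.
have [Rtot Stot] := (well_order_total woR, well_order_total woS).
have [Rtr Str] := (well_order_trans woR, well_order_trans woS).
have [f f_cof] := unbounded_map_cofinal Stot nbKL.
have [g g_cof] := unbounded_map_cofinal Rtot nbLK.
have leKL : [set: K] #<= [set: L].
  apply: (card_le_trans _ (card_image_le g setT)).
  by apply: Kreg => i; have [l il] := g_cof i; exists (g l) => //; exists l.
pose below i := [set j | R j i /\ j <> i].
pose ub i := [set l | forall j, below i j -> S (f j) l].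
have ub_neq0 i : ub i !=set0.
  apply: contrapT => /set0P/negP/negPn/eqP no_ub; apply: (Kinit i).
  apply: card_le_trans leKL _; apply: (card_le_trans _ (card_image_le f _)).
  apply: Lreg => l; apply: contrapT => nol.
  suff: ub i l by rewrite no_ub.
  move=> j ji; have /orP[//|lfj] := Stot (f j) l.
  by case: nol; exists (f j) => //; exists j.
have h_ex i : exists l, ub i l /\ forall m, ub i m -> S l m.
  by have [l] := well_order_min woS (ub i) (ub_neq0 i); exists l.
have [h h_least] := choice h_ex.
have h_ub i : ub i (h i) by case: (h_least i).
have h_min i l : ub i l -> S (h i) l by case: (h_least i) => _; apply.
exists h; split=> [i j ij|l].
  apply: h_min => k [ki nki]; apply: h_ub; split; first exact: Rtr ki ij.
  by move=> kj; apply: nki; apply: (well_order_anti woR); rewrite ki kj ij.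
(* [h j] bounds [f] only strictly below [j], so [j] is taken beyond [i]. *)
have [i li] := f_cof l; have [j [ij nji]] := regular_no_max regK i.
by exists j; apply: Str li _; apply: h_ub; split=> // /esym.
Qed.

(** * Free ultrafilters *)

Local Instance Nstar_ultra (x : Nstar) : UltraFilter (ufilter x) :=
  ufilter_ultra x.

Lemma Nstar_tail (p : Nstar) N : ufilter p [set n | N <= n].
Proof.
elim: N => [|N IHN]; first exact: filterS filterT.
have [a pa aN] : exists2 a, ufilter p a & ~ a N.
  apply: contrapT => noa; suff: (\bigcap_(a in ufilter p) a) N.
    by rewrite (ufilter_free p).
  by move=> a pa; apply: contrapT => aN; apply: noa; exists a.
apply: filterS (filterI IHN pa) => n [/= Nn an].
rewrite ltn_neqAle Nn andbT; apply/eqP => NE.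
by move: an; rewrite -NE.
Qed.

Lemma ufilter_almost_subset {p : Nstar} {a b : set nat} :
  almost_subset a b -> ufilter p a -> ufilter p b.
Proof.
move=> /almost_subsetP[N ab] pa.
by apply: filterS (filterI (Nstar_tail p N) pa) => n [/= Nn /(ab n Nn)].
Qed.

Lemma ufilter_setC {p : Nstar} {a : set nat} :
  ufilter p (~` a) <-> ~ ufilter p a.
Proof.
split=> [pa'|pa]; last by case: (in_ultra_setVsetC a (ufilter_ultra p)).
move=> pa; apply: (filter_not_empty (ufilter p)).
by rewrite -(setICr a); apply: filterI.
Qed.

(** The filter consists of the sets that almost contain a member of [B]; closing
    up modulo finite sets is what makes any ultrafilter above it free. *)
Lemma free_ultrafilter_extension (B : set (set nat)) :
  B !=set0 -> (forall e, B e -> infinite_set e) ->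
  (forall e f, B e -> B f -> exists2 g, B g & g `<=` e `&` f) ->
  exists p : Nstar, forall e, B e -> ufilter p e.
Proof.
move=> [e0 Be0] Binf Bdir.
pose F : set_system nat := [set d | exists2 e, B e & almost_subset e d].
have FF : ProperFilter F.
  apply: Build_ProperFilter_ex.
    move=> d [e Be /almost_subsetP[N ed]].
    by have /infinite_nat_setP/(_ N)[n /ed dn /dn] := Binf e Be; exists n.
  split; first by exists e0 => //; apply: subset_almost.
  - move=> d d' [e Be ed] [f Bf fd']; have [g Bg gef] := Bdir e f Be Bf.
    exists g => //; apply: almost_subsetI.
      by apply: almost_subset_trans ed; apply: subset_almost => n /gef[].
    by apply: almost_subset_trans fd'; apply: subset_almost => n /gef[].
  - move=> d d' dd' [e Be ed]; exists e => //.
    exact: almost_subset_trans ed (subset_almost dd').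
have [G [Gultra FG]] := ultraFilterLemma FF.
have Gfree : \bigcap_(a in G) a = set0.
  apply/seteqP; split=> // n Gn; suff: [set m | n < m] n by rewrite /= ltnn.
  apply: Gn; apply: FG; exists e0 => //.
  by apply/almost_subsetP; exists n.+1.
exists (MkNstar Gultra Gfree) => e Be /=.
by apply: FG; exists e => //; apply: subset_almost.
Qed.

Lemma infinite_star {a : set nat} : infinite_set a -> star a !=set0.
Proof.
move=> ainf.
have [|_ ->//|_ _ -> ->|p pa] := free_ultrafilter_extension [set a].
- by exists a.
- by exists a.
- by exists p; apply: pa.
Qed.

(** * Two speeds of convergence to one ultrafilter *)

Definition tail_converges {L : Type} (S : rel L) (E : L -> set nat)
    (x : Nstar) :=
  forall c, ufilter x c ->
    exists l, forall l', S l l' -> almost_subset (E l') c.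

Lemma common_pseudo_intersection {I L : Type} {S : rel L} {E : L -> set nat}
    {x : Nstar} (c : I -> set nat) :
  tail_converges S E x -> bounded_maps I L S -> (forall i, ufilter x (c i)) ->
  exists l, forall i, almost_subset (E l) (c i).
Proof.
move=> Ex bI xc; have [f fP] := choice (fun i => Ex _ (xc i)).
by have [l lP] := bI f; exists l => i; apply: fP.
Qed.

(** Two families converging to one ultrafilter cannot have lengths so far apart
    that all maps from [K] to [L] are bounded.  For if they are, one [E l] serves
    [K] many members of [x] at once, even members indexed by pairs.  The step
    [undominated] uses this to exclude a [g] that bounds the gaps of every [D i]
    at x-many places, so that the [D i] yield a dominating family indexed by
    [K * K]; each of its members defines a set that splits every set whose
    enumeration it dominates, and a second use gives an [E l] split by none of these sets,
    although one of the members dominates its enumeration. *)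
Lemma exists_unbounded_map (x : Nstar) (K L : Type) (S : rel L)
    (D : K -> set nat) (E : L -> set nat) :
  transitive S ->
  (forall i, infinite_set (D i)) -> (forall l, infinite_set (E l)) ->
  (forall c, ufilter x c -> exists i, almost_subset (D i) c) ->
  tail_converges S E x ->
  ~ bounded_maps K L S.
Proof.
move=> Str Dinf Einf Dx Ex bK.
have undominated (g : nat -> nat) :
    exists i, ufilter x [set n | forall m, D i m -> n <= m -> g n < m].
  apply: contrapT => nog.
  have xnear i : ufilter x [set n | exists2 m, D i m & n <= m <= g n].
    have [xi|xi] := in_ultra_setVsetC
        [set n | forall m, D i m -> n <= m -> g n < m] (ufilter_ultra x).
      by case: nog; exists i.
    apply: filterS xi => n /=; apply: contra_notP => nonear m Dm nm.
    by rewrite ltnNge; apply/negP => mg; apply: nonear; exists m; rewrite ?nm.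
  have [l El] := common_pseudo_intersection _ Ex bK xnear.
  have [c cP] := interval_splitting (E l) g (Einf l).
  have Dc i : ~ almost_subset (D i) c /\ ~ almost_subset (D i) (~` c).
    by apply: cP; have /almost_subsetP := El i.
  have [/Dx[i]|/Dx[i]] := in_ultra_setVsetC c (ufilter_ultra x).
    by case: (Dc i).
  by case: (Dc i).
have [next nextP] := choice (fun i => infinite_next (Dinf i)).
(* The intervals of [c (i, j)] run from n to an element of [D i] beyond an
   element of [D j] beyond n. *)
have [c cP] := choice (fun ij : K * K =>
  interval_splitting setT (next ij.1 \o next ij.2) infinite_nat).
pose c' ij := if `[< ufilter x (c ij) >] then c ij else ~` c ij.
have xc' ij : ufilter x (c' ij).
  rewrite /c'; case: asboolP => // ncx.
  by case: (in_ultra_setVsetC (c ij) (ufilter_ultra x)).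
have [l El] :=
  common_pseudo_intersection c' Ex (bounded_maps_pair Str bK) xc'.
have [g gP] := infinite_next (Einf l).
have [i /[dup] xi /Dx[j /almost_subsetP[N Dj]]] := undominated g.
(* The element of [D j] between n and the end of the interval is one of the
   places where the next element of [D i] exceeds [g], hence lies beyond a
   point of [E l]. *)
have [|Ec EcC] := cP (i, j) (E l).
  exists N => n Nn _ /=; have [np Dp] := nextP j n.
  have [pm Dm] := nextP i (next j n).
  have [pe Ee] := gP (next j n); exists (g (next j n)) => //.
  have := Dj _ (leq_trans Nn np) Dp _ Dm pm; lia.
by have := El (i, j); rewrite /c'; case: asboolP.
Qed.

(** * Almost clopen sets and their ideals *)

Lemma open_star a : open (star a).
Proof.
exists [set a]; last exact: bigcup_set1.
by [].
Qed.

Lemma nbhs_starP (p : Nstar) (S : set Nstar) :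
  nbhs p S <-> exists2 a, ufilter p a & star a `<=` S.
Proof.
split=> [|[a pa aS]]; last first.
  by apply: filterS aS _; apply: open_nbhs_nbhs; split=> //; apply: open_star.
rewrite nbhsE => -[U [[D _ <-] [a Da pa]] US].
by exists a => // q qa; apply: US; exists a.
Qed.

Lemma clopen_ideal0 A : clopen_ideal A set0.
Proof. by move=> p /filter_not_empty. Qed.

Lemma clopen_idealU A (a b : set nat) :
  clopen_ideal A a -> clopen_ideal A b -> clopen_ideal A (a `|` b).
Proof.
move=> Aa Ab p; rewrite /star /= => pab.
have [/Aa//|/ufilter_setC pa] := pselect (ufilter p a).
by apply: Ab; apply: filterS (filterI pab pa) => n [[]].
Qed.

Lemma interior_clopen_ideal A (p : Nstar) :
  A° p <-> exists2 a, clopen_ideal A a & ufilter p a.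
Proof. by rewrite /interior nbhs_starP; split=> -[a]; exists a. Qed.

Lemma almost_clopen_closed A : almost_clopen A -> closed A.
Proof. by move=> [[U _ ->] _]; apply: closed_closure. Qed.

Lemma boundary_not_ideal A x a :
  boundary A x -> clopen_ideal A a -> ~ ufilter x a.
Proof.
by move=> [_ nAx] Aa xa; apply: nAx; apply/interior_clopen_ideal; exists a.
Qed.

Lemma almost_clopen_cover A x p : almost_clopen A -> boundary A x ->
  A p -> p <> x -> exists2 a, clopen_ideal A a & ufilter p a.
Proof.
move=> [_ [y [_ y_uniq]]] bx Ap npx; apply/interior_clopen_ideal.
apply: contrapT => nAp; apply: npx; rewrite -(y_uniq x bx); apply/esym/y_uniq.
by split=> //; apply: subset_closure.
Qed.

(** Every neighbourhood of the boundary point meets the interior, because an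
    almost clopen set is the closure of an open set. *)
Lemma ideal_meets_boundary_nbhs A x c : almost_clopen A -> boundary A x ->
  ufilter x c -> exists p a, [/\ ufilter p c, clopen_ideal A a & ufilter p a].
Proof.
move=> [[U Uop AU] _] [Ax _] xc.
have {}Ax : closure U x by move: Ax; rewrite AU; apply: closed_closure.
have [|p [Up pc]] := Ax (star c); first by apply/nbhs_starP; exists c.
have [a pa aU] : exists2 a, ufilter p a & star a `<=` U.
  by apply/nbhs_starP/open_nbhs_nbhs.
exists p, a; split=> // q /aU Uq; rewrite AU; exact: subset_closure.
Qed.

(** The complement of [a] is a neighbourhood of the boundary point, hence meets
    the interior in a point whose witness in the ideal is not almost contained
    in [a]. *)
Lemma clopen_ideal_no_largest A x a : almost_clopen A -> boundary A x ->
  clopen_ideal A a -> exists2 b, clopen_ideal A b & ~ almost_subset b a.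
Proof.
move=> aA bx Aa.
have /ufilter_setC/(ideal_meets_boundary_nbhs A x _ aA bx) :=
  boundary_not_ideal A x a bx Aa.
move=> [p [b [/ufilter_setC pa Ab pb]]]; exists b => // ba.
exact: pa (ufilter_almost_subset ba pb).
Qed.

(** If a neighbourhood of [x] were contained in the complement, it would meet
    some basic clopen subset of [A] in a point of both sets, that is in [x]
    itself, making [x] an interior point of [A]. *)
Lemma boundary_complement A x : almost_clopen A -> boundary A x ->
  boundary ([set x] `|` ~` A) x.
Proof.
move=> aA bx; split; first by apply: subset_closure; left.
move=> /interior_clopen_ideal[b Bb xb].
have [p [a [pb Aa pa]]] := ideal_meets_boundary_nbhs A x b aA bx xb.
apply: (boundary_not_ideal A x a bx Aa).
case: (Bb p pb) => [<-//|[]]; exact: Aa.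
Qed.

(** A common infinite part of [a] and [b] would carry a free ultrafilter lying
    in both sets, that is [x]; but [x] has no neighbourhood inside [A]. *)
Lemma clopen_ideals_orthogonal A x a b : boundary A x ->
  clopen_ideal A a -> clopen_ideal ([set x] `|` ~` A) b -> finite_set (a `&` b).
Proof.
move=> bx Aa Bb; apply: contrapT => /infinite_star[p pab].
have pa : ufilter p a by apply: filterS pab => n [].
have pb : ufilter p b by apply: filterS pab => n [].
case: (Bb p pb) => [px|[]]; last exact: Aa.
by apply: (boundary_not_ideal A x a) => //; rewrite -px.
Qed.

(** Otherwise some free ultrafilter contains [~` c] and avoids both ideals.  It
    is not [x], so it lies inside one of the two open sets that make up the rest
    of the space, and therefore meets the ideal of that set. *)
Lemma clopen_ideals_generate A x c : almost_clopen A -> boundary A x ->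
  ufilter x c ->
  exists a b, [/\ clopen_ideal A a, clopen_ideal ([set x] `|` ~` A) b &
    almost_subset (~` c) (a `|` b)].
Proof.
set B := _ `|` ~` A => aA bx xc; apply: contrapT => noab.
pose X := [set ~` c `\` (ab.1 `|` ab.2) |
  ab in [set ab | clopen_ideal A ab.1 /\ clopen_ideal B ab.2]].
have [||e f|p pX] := free_ultrafilter_extension X.
- by exists (~` c `\` (set0 `|` set0)); exists (set0, set0) => //;
    split; apply: clopen_ideal0.
- by move=> _ [[a b] /= [Aa Bb] <-] fin; apply: noab; exists a, b.
- move=> [[a b] /= [Aa Bb] <-] [[a' b'] /= [Aa' Bb'] <-].
  exists (~` c `\` ((a `|` a') `|` (b `|` b'))).
    by exists (a `|` a', b `|` b') => //; split; apply: clopen_idealU.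
  by move=> n [cn nab]; split; split=> // -[?|?]; apply: nab;
    do ?[by left; left | by left; right | by right; left | by right; right].
have pavoid a b : clopen_ideal A a -> clopen_ideal B b ->
    ufilter p (~` c `\` (a `|` b)).
  by move=> Aa Bb; apply: pX; exists (a, b).
have [A0 B0] := (clopen_ideal0 A, clopen_ideal0 B).
have npx : p <> x.
  move=> px; have := pavoid _ _ A0 B0; rewrite px => xc'.
  have /ufilter_setC[] : ufilter x (~` c) by apply: filterS xc' => n [].
  exact: xc.
have [Ap|nAp] := pselect (A p).
  have [a Aa pa] := almost_clopen_cover A x p aA bx Ap npx.
  have [n [[_ nab] an]] := filter_ex (filterI (pavoid _ _ Aa B0) pa).
  by apply: nab; left.
have [b pb bA] : exists2 b, ufilter p b & star b `<=` ~` A.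
  apply/nbhs_starP/open_nbhs_nbhs; split=> //.
  by apply: closed_openC; exact: almost_clopen_closed.
have Bb : clopen_ideal B b by move=> q /bA; right.
have [n [[_ nab] bn]] := filter_ex (filterI (pavoid _ _ A0 Bb) pb).
by apply: nab; right.
Qed.

(** * Increments of a chain converge to the boundary point *)

(** If [~` c] is almost covered by [d `|` e] with [d] in [I] and [e] in [J], and
    [a_i] almost contains [d], then past [i] an increment of the chain, being
    almost disjoint from [a_i] and from [e], is almost contained in [c].  The
    ideals are kept abstract because the lemma serves both chains, with [I] and
    [J] exchanged. *)
Lemma chain_increments_converge (I J : set (set nat)) (x : Nstar)
    (K : Type) (R : rel K) (a : K -> set nat) :
  (forall d e, I d -> J e -> finite_set (d `&` e)) ->
  (forall c, ufilter x c -> exists d e,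
    [/\ I d, J e & almost_subset (~` c) (d `|` e)]) ->
  (forall d, I d -> exists2 e, I e & ~ almost_subset e d) ->
  (forall i, I (a i)) ->
  (forall i j, R i j -> almost_subset (a i) (a j)) ->
  (forall d, I d -> exists i, almost_subset d (a i)) ->
  exists2 D : K -> set nat, forall i, infinite_set (D i) & tail_converges R D x.
Proof.
move=> orth gen nomax Ia a_mono a_cof.
have grow i : exists j, ~ almost_subset (a j) (a i).
  have [e /a_cof[j ej] nei] := nomax _ (Ia i).
  by exists j => ji; apply: nei; apply: almost_subset_trans ej ji.
have [next nextP] := choice grow.
exists (fun i => a (next i) `\` a i) => [i|c xc]; first exact: nextP.
have [d [e [Id Je]]] := gen c xc; have [i di] := a_cof d Id.
move=> /almost_subsetP[N1 cde]; exists i => j ij.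
have /almost_subsetP[N2 dj] := almost_subset_trans di (a_mono i j ij).
have /finite_nat_setP[N3 ae] := orth _ _ (Ia (next j)) Je.
apply/almost_subsetP; exists (maxn N1 (maxn N2 N3)) => n nN [an naj].
apply: contrapT => cn; have [|dn|en] := cde n _ cn; first by lia.
  by apply: naj; apply: dj => //; lia.
by apply: (ae n) => //; lia.
Qed.

(** * Equality of the types *)

Theorem theorem2p4 (K : Type) (R : rel K) (A : set Nstar) (xA : Nstar) :
  regular_cardinal R ->
  simple_of_type R A ->
  boundary A xA ->
  simple ([set xA] `|` ~` A) ->
  simple_of_type R ([set xA] `|` ~` A).
Proof.
move=> regK [aA [a [Ia a_mono a_cof]]] bA.
move=> [L [S [regL [aB [b [Ib b_mono b_cof]]]]]].
split=> //; set B := _ `|` _ in aB Ib b_cof *.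
have bB : boundary B xA by apply: boundary_complement.
have orth d e := clopen_ideals_orthogonal A xA d e bA.
have gen c := clopen_ideals_generate A xA c aA bA.
have [D Dinf Dx] := chain_increments_converge (clopen_ideal A) (clopen_ideal B)
  xA K R a orth gen (fun d => clopen_ideal_no_largest A xA d aA bA)
  Ia a_mono a_cof.
have [E Einf Ex] : exists2 E : L -> set nat,
    forall l, infinite_set (E l) & tail_converges S E xA.
  apply: (chain_increments_converge (clopen_ideal B) (clopen_ideal A) xA L S b)
    => // [d e Bd Ae|c /gen[d [e [Ad Be cde]]]|d].
  - by rewrite setIC; apply: orth.
  - by exists e, d; rewrite setUC.
  - exact: clopen_ideal_no_largest aB bB.
have [[woR _ _ _] [woS _ _ _]] := (regK, regL).
have conv (M : Type) (T : rel M) (G : M -> set nat) : well_order T ->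
    tail_converges T G xA ->
    forall c, ufilter xA c -> exists m, almost_subset (G m) c.
  move=> woT Gx c /Gx[m mP]; exists m; apply: mP.
  by have /orP[] := well_order_total woT m m.
have nbKL : ~ bounded_maps K L S.
  exact: exists_unbounded_map (well_order_trans woS) Dinf Einf
    (conv _ _ _ woR Dx) Ex.
have nbLK : ~ bounded_maps L K R.
  exact: exists_unbounded_map (well_order_trans woR) Einf Dinf
    (conv _ _ _ woS Ex) Dx.
have [f [f_mono f_cof]] := regular_monotone_cofinal regK regL nbKL nbLK.
exists (b \o f); split=> [i|i j ij|c /b_cof[l cl]] /=.
- exact: Ib.
- exact: b_mono (f_mono i j ij).
have [i li] := f_cof l; exists i.
exact: almost_subset_trans cl (b_mono l (f i) li).
Qed.
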